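(* Let $(D,\dashv,\vdash,\theta_{\dashv},\theta_{\vdash})$ be a diassociative bialgebra and $(B,\diamond,\varpi)$ a quadratic Zinbiel algebra. Equip $D\otimes B$ with the product $(d_1\otimes b_1)\cdot(d_2\otimes b_2)=(d_1\vdash d_2)\otimes(b_1\diamond b_2)+(d_1\dashv d_2)\otimes(b_2\diamond b_1)$, and define a linear map $\Delta: D\otimes B\to(D\otimes B)\otimes(D\otimes B)$ by $$\Delta(d\otimes b)=\theta_{\vdash}(d)\bullet\nu_{\varpi}(b)+\theta_{\dashv}(d)\bullet\tau(\nu_{\varpi}(b))$$ for all $d\in D$, $b\in B$. Then $(D\otimes B,\cdot,\Delta)$ is an antisymmetric infinitesimal (ASI) bialgebra. In particular, $(D\otimes B,\cdot,\Delta)$ is a triangular ASI bialgebra if $(D,\dashv,\vdash,\theta_{\dashv},\theta_{\vdash})$ is a triangular diassociative bialgebra.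
   Context: All vector spaces are finite-dimensional over a field $\Bbbk$ of characteristic zero; $\tau(x\otimes y)=y\otimes x$; $(d'\otimes d'')\bullet(b'\otimes b''):=(d'\otimes b')\otimes(d''\otimes b'')$, extended bilinearly. Diassociative algebra $(D,\dashv,\vdash)$: two associative bilinear products on $D$ with $(d_1\dashv d_2)\dashv d_3=d_1\dashv(d_2\vdash d_3)$, $(d_1\vdash d_2)\dashv d_3=d_1\vdash(d_2\dashv d_3)$, $(d_1\dashv d_2)\vdash d_3=(d_1\vdash d_2)\vdash d_3$. Write $\mathbf l_{\dashv}(d)(x)=d\dashv x$, $\mathbf r_{\dashv}(d)(x)=x\dashv d$, $\mathbf l_{\vdash}(d)(x)=d\vdash x$, $\mathbf r_{\vdash}(d)(x)=x\vdash d$. Diassociative coalgebra $(D,\theta_\dashv,\theta_\vdash)$: $\theta_\dashv,\theta_\vdash:D\to D\otimes D$ coassociative with $(\theta_\dashv\otimes\mathrm{id})\theta_\dashv=(\mathrm{id}\otimes\theta_\vdash)\theta_\dashv$, $(\theta_\vdash\otimes\mathrm{id})\theta_\dashv=(\mathrm{id}\otimes\theta_\dashv)\theta_\vdash$, $(\theta_\dashv\otimes\mathrm{id})\theta_\vdash=(\theta_\vdash\otimes\mathrm{id})\theta_\vdash$. Diassociative bialgebra: both structures on $D$ such that for all $d_1,d_2\in D$: (1) $(\mathrm{id}\otimes\mathbf l_\dashv(d_1))\theta_\dashv(d_2)=(\mathbf r_\vdash(d_2)\otimes\mathrm{id})\theta_\vdash(d_1)$; (2) $(\mathbf l_\dashv(d_1)\otimes\mathrm{id})\theta_\vdash(d_2)=(\mathrm{id}\otimes\mathbf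 l_\dashv(d_2))\tau\theta_\vdash(d_1)$; (3) $(\mathbf r_\vdash(d_1)\otimes\mathrm{id})\tau\theta_\dashv(d_2)=(\mathrm{id}\otimes\mathbf r_\vdash(d_2))\theta_\dashv(d_1)$; (4) $\theta_\vdash(d_1\vdash d_2)=(\mathrm{id}\otimes\mathbf l_\vdash(d_1))\theta_\vdash(d_2)-((\mathbf r_\vdash-\mathbf r_\dashv)(d_2)\otimes\mathrm{id})(\theta_\vdash-\theta_\dashv)(d_1)$; (5) $\theta_\vdash(d_1\dashv d_2)=(\mathrm{id}\otimes\mathbf l_\dashv(d_1))(\theta_\vdash-\theta_\dashv)(d_2)+(\mathbf r_\dashv(d_2)\otimes\mathrm{id})\theta_\vdash(d_1)$; (6) $\theta_\dashv(d_1\vdash d_2)=(\mathrm{id}\otimes(\mathbf l_\vdash-\mathbf l_\dashv)(d_1))\theta_\dashv(d_2)+(\mathbf r_\vdash(d_2)\otimes\mathrm{id})\theta_\dashv(d_1)$; (7) $\theta_\dashv(d_1\dashv d_2)=(\mathbf r_\dashv(d_2)\otimes\mathrm{id})\theta_\dashv(d_1)-(\mathrm{id}\otimes(\mathbf l_\vdash-\mathbf l_\dashv)(d_1))(\theta_\vdash-\theta_\dashv)(d_2)$; (8) $((\mathbf l_\vdash-\mathbf l_\dashv)(d_1)\otimes\mathrm{id})\theta_\vdash(d_2)+(\mathrm{id}\otimes\mathbf l_\dashv(d_2))\tau\theta_\dashv(d_1)=((\mathbf r_\vdash-\mathbf r_\dashv)(d_2)\otimes\mathrm{id})\tau(\theta_\vdash-\theta_\dashv)(d_1)+(\mathrm{id}\otimes\mathbf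 r_\dashv(d_1))\theta_\vdash(d_2)$; (9) $(\mathbf r_\dashv(d_1)\otimes\mathrm{id})\tau\theta_\dashv(d_2)+(\mathrm{id}\otimes\mathbf r_\vdash(d_2))(\theta_\vdash-\theta_\dashv)(d_1)=((\mathbf l_\vdash-\mathbf l_\dashv)(d_2)\otimes\mathrm{id})(\theta_\vdash-\theta_\dashv)(d_1)+(\mathrm{id}\otimes\mathbf l_\vdash(d_1))\tau\theta_\dashv(d_2)$. Triangular diassociative bialgebra: there is $r=\sum_i x_i\otimes y_i\in D\otimes D$ with $\tau(r)=r$ solving the diassociative Yang-Baxter equation $\sum_{i,j}\big(x_i\otimes x_j\otimes(y_i\vdash y_j)-x_j\otimes(x_i\dashv y_j)\otimes y_i-(x_i\vdash x_j)\otimes y_i\otimes y_j+(x_i\dashv x_j)\otimes y_i\otimes y_j\big)=0$, and $\theta_\dashv(d)=\big(\mathrm{id}\otimes(\mathbf l_\vdash-\mathbf l_\dashv)(d)-\mathbf r_\vdash(d)\otimes\mathrm{id}\big)(r)$, $\theta_\vdash(d)=-\big((\mathbf r_\vdash-\mathbf r_\dashv)(d)\otimes\mathrm{id}+\mathrm{id}\otimes\mathbf l_\dashv(d)\big)(r)$ for all $d$. Zinbiel algebra $(B,\diamond)$: bilinear $\diamond$ with $b_1\diamond(b_2\diamond b_3)=(b_1\diamond b_2)\diamond b_3+(b_2\diamond b_1)\diamond b_3$. Quadratic Zinbiel algebra $(B,\diamond,\varpi)$: a Zinbiel algebra with a nondegenerate skew-symmetric bilinear form $\varpi$ with $\varpi(b_1\diamond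 b_2,b_3)=\varpi(b_2,b_1\diamond b_3+b_3\diamond b_1)$. The map $\nu_\varpi:B\to B\otimes B$ is defined by $\varpi(\nu_\varpi(b_1),b_2\otimes b_3)=\varpi(b_1,b_2\diamond b_3)$, where $\varpi(a\otimes b,a'\otimes b')=\varpi(a,a')\varpi(b,b')$. ASI bialgebra $(A,\cdot,\Delta)$: $(A,\cdot)$ is an associative algebra, $\Delta:A\to A\otimes A$ is coassociative, and with $\mathbf l_A(a)(x)=a\cdot x$, $\mathbf r_A(a)(x)=x\cdot a$, for all $a_1,a_2$: $\Delta(a_1\cdot a_2)=(\mathbf r_A(a_2)\otimes\mathrm{id})\Delta(a_1)+(\mathrm{id}\otimes\mathbf l_A(a_1))\Delta(a_2)$ and $(\mathbf l_A(a_1)\otimes\mathrm{id}-\mathrm{id}\otimes\mathbf r_A(a_1))\Delta(a_2)=\tau\big((\mathrm{id}\otimes\mathbf r_A(a_2)-\mathbf l_A(a_2)\otimes\mathrm{id})\Delta(a_1)\big)$. It is triangular if there is $s=\sum_i u_i\otimes v_i\in A\otimes A$ with $\tau(s)=-s$, $\sum_{i,j}\big((u_i\cdot u_j)\otimes v_i\otimes v_j+u_i\otimes u_j\otimes(v_i\cdot v_j)-u_j\otimes(u_i\cdot v_j)\otimes v_i\big)=0$, and $\Delta(a)=(\mathrm{id}\otimes\mathbf l_A(a)-\mathbf r_A(a)\otimes\mathrm{id})(s)$ for all $a\in A$. *)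

(* Defs.v *)
From HB Require Import structures.
From mathcomp Require Import all_boot all_order all_algebra.

Set Implicit Arguments.
Unset Strict Implicit.
Unset Printing Implicit Defensive.

Import GRing.Theory.
Local Open Scope ring_scope.

(* Tensor products of finite-dimensional spaces, in coordinates: a tensor is
   the matrix of its coefficients on the basis (e_i ⊗ f_j), where (e_i) and
   (f_j) are the standard bases given by vbasis. The universal property is
   tliftE together with tens_ext. *)

Definition tens (k : fieldType) (U V : vectType k) : Type :=
  'M[k]_(\dim (fullv : {vspace U}), \dim (fullv : {vspace V})).

HB.instance Definition _ (k : fieldType) (U V : vectType k) :=
  Vector.on (tens U V).

Definition tpure (k : fieldType) (U V : vectType k) (u : U) (v : V) : tens U V :=
  \matrix_(i, j) (coord (vbasis fullv) i u * coord (vbasis fullv) j v).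

Notation "u ⊗ v" := (tpure u v) (at level 40, left associativity) : ring_scope.

(* The linear map U ⊗ V -> W induced by f : U -> V -> W. It sends u ⊗ v to
   f u v only when f is bilinear. *)
Definition tlift (k : fieldType) (U V : vectType k) (W : lmodType k)
    (f : U -> V -> W) (t : tens U V) : W :=
  \sum_i \sum_j t i j *: f (vbasis fullv)`_i (vbasis fullv)`_j.

Section TensorTheory.
Variable k : fieldType.
Implicit Types U V D B : vectType k.

Fact tlift_is_linear U V (W : lmodType k) (f : U -> V -> W) : linear (tlift f).
Proof.
move=> a s t; rewrite /tlift scaler_sumr -big_split; apply: eq_bigr => i _ /=.
rewrite scaler_sumr -big_split; apply: eq_bigr => j _ /=.
by rewrite !mxE scalerDl scalerA.
Qed.

Fact tlift_linear_param U V (X W : lmodType k) (h : U -> V -> X -> W) t :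
  (forall u v, linear (h u v)) -> linear (fun x => tlift (fun u v => h u v x) t).
Proof.
move=> h_lin a x y; rewrite /tlift scaler_sumr -big_split.
apply: eq_bigr => i _ /=; rewrite scaler_sumr -big_split.
by apply: eq_bigr => j _ /=; rewrite h_lin scalerDr !scalerA mulrC.
Qed.

HB.instance Definition _ U V (W : lmodType k) (f : U -> V -> W) :=
  GRing.isLinear.Build k (tens U V) W _ (tlift f) (tlift_is_linear f).

Fact tpure_is_bilinear U V :
  @bilinear_for k U V (tens U V) *:%R *:%R (@tpure k U V).
Proof.
split=> [v a u u' | u a v v']; apply/matrixP => i j; rewrite !mxE linearP /=.
  by rewrite mulrDl mulrA.
by rewrite mulrDr mulrCA.
Qed.

HB.instance Definition _ U V :=
  bilinear_isBilinear.Build k U V (tens U V) *:%R *:%R (@tpure k U V)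
    (tpure_is_bilinear U V).

Lemma tliftE U V (W : lmodType k) (f : U -> V -> W) u v :
  bilinear_for *:%R *:%R f -> tlift f (u ⊗ v) = f u v.
Proof.
move=> f_bilin; pose fB := bilinear_isBilinear.Build k U V W *:%R *:%R f f_bilin.
pose F : {bilinear U -> V -> W} := HB.pack f fB.
rewrite -[f]/(F : _ -> _ -> _).
rewrite [in RHS](coord_vbasis (memvf u)) [in RHS](coord_vbasis (memvf v)).
rewrite linear_sumlz; apply: eq_bigr => i _.
rewrite linear_sumr; apply: eq_bigr => j _.
by rewrite mxE linearZl_LR linearZr_LR /= scalerA.
Qed.

Lemma tens_coordE U V (t : tens U V) :
  t = tlift (@tpure k U V) t.
Proof.
apply/matrixP => i j; rewrite summxE (bigD1 i) //= summxE (bigD1 j) //= !mxE.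
rewrite !(coord_free, basis_free (vbasisP _)) // !eqxx !mulr1.
rewrite [X in _ + X + _]big1 => [|j' /negPf nj].
  rewrite [X in _ + X]big1 ?addr0 // => i' /negPf ni.
  rewrite summxE big1 // => j' _; rewrite !mxE.
  by rewrite !(coord_free, basis_free (vbasisP _)) // ni mul0r mulr0.
by rewrite !mxE !(coord_free, basis_free (vbasisP _)) // nj !mulr0.
Qed.

Lemma tens_ext U V (W : lmodType k) (f g : {linear tens U V -> W}) :
  (forall u v, f (u ⊗ v) = g (u ⊗ v)) -> f =1 g.
Proof.
move=> fg t; rewrite (tens_coordE t) !linear_sum; apply: eq_bigr => i _.
by rewrite !linear_sum; apply: eq_bigr => j _; rewrite !linearZ fg.
Qed.

Definition tmap U V (U' V' : vectType k) (f : U -> U') (g : V -> V') :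
    tens U V -> tens U' V' :=
  tlift (fun u v => f u ⊗ g v).

Definition tswap U V : tens U V -> tens V U := tlift (fun u v => v ⊗ u).

Definition tassoc U V W : tens (tens U V) W -> tens U (tens V W) :=
  tlift (fun (uv : tens U V) (w : W) => tlift (fun u v => u ⊗ (v ⊗ w)) uv).

HB.instance Definition _ U V (U' V' : vectType k) (f : U -> U') (g : V -> V') :=
  GRing.Linear.on (tmap f g).
HB.instance Definition _ U V := GRing.Linear.on (@tswap U V).
HB.instance Definition _ U V W := GRing.Linear.on (@tassoc U V W).

Definition tbullet D B (p : tens D D) (q : tens B B) :
    tens (tens D B) (tens D B) :=
  tlift (fun d' d'' => tlift (fun b' b'' => (d' ⊗ b') ⊗ (d'' ⊗ b'')) q) p.

Definition tform B (w : B -> B -> k) (p q : tens B B) : k :=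
  tlift (fun a b => tlift (fun a' b' => w a a' * w b b' : k^o) q) p.

End TensorTheory.

Notation "p • q" := (tbullet p q) (at level 40, left associativity) : ring_scope.

Section Dias.
Variables (k : fieldType) (D : vectType k).

Section Algebra.
Variables dl dr : {bilinear D -> D -> D}.
Local Notation "x ⊣ y" := (dl x y) (at level 40, left associativity).
Local Notation "x ⊢ y" := (dr x y) (at level 40, left associativity).

Record is_diass_algebra : Prop := IsDiassAlgebra {
  diass_dlA : forall x y z, (x ⊣ y) ⊣ z = x ⊣ (y ⊣ z);
  diass_drA : forall x y z, (x ⊢ y) ⊢ z = x ⊢ (y ⊢ z);
  diass_dl_dr : forall x y z, (x ⊣ y) ⊣ z = x ⊣ (y ⊢ z);
  diass_dr_dl : forall x y z, (x ⊢ y) ⊣ z = x ⊢ (y ⊣ z);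
  diass_bar : forall x y z, (x ⊣ y) ⊢ z = (x ⊢ y) ⊢ z
}.

End Algebra.

Section Coalgebra.
Variables tl tr : {linear D -> tens D D}.

Record is_diass_coalgebra : Prop := IsDiassCoalgebra {
  codiass_tlA : forall x, tassoc (tmap tl id (tl x)) = tmap id tl (tl x);
  codiass_trA : forall x, tassoc (tmap tr id (tr x)) = tmap id tr (tr x);
  codiass_tl_tr : forall x, tassoc (tmap tl id (tl x)) = tmap id tr (tl x);
  codiass_tr_tl : forall x, tassoc (tmap tr id (tl x)) = tmap id tl (tr x);
  codiass_bar : forall x, tmap tl id (tr x) = tmap tr id (tr x)
}.

End Coalgebra.

Section Bialgebra.
Variables (dl dr : {bilinear D -> D -> D}) (tl tr : {linear D -> tens D D}).
Local Notation "x ⊣ y" := (dl x y) (at level 40, left associativity).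
Local Notation "x ⊢ y" := (dr x y) (at level 40, left associativity).
Local Notation "'l⊣' d" := (dl d) (at level 10, d at level 9).
Local Notation "'r⊣' d" := (fun x => x ⊣ d) (at level 10, d at level 9).
Local Notation "'l⊢' d" := (dr d) (at level 10, d at level 9).
Local Notation "'r⊢' d" := (fun x => x ⊢ d) (at level 10, d at level 9).
Local Notation "'θ⊣'" := tl.
Local Notation "'θ⊢'" := tr.
Local Notation τ := (@tswap k D D).

Record is_diass_bialgebra : Prop := IsDiassBialgebra {
  dibi_algebra : is_diass_algebra dl dr;
  dibi_coalgebra : is_diass_coalgebra tl tr;
  dibi1 : forall d1 d2,
    tmap id (l⊣ d1) (θ⊣ d2) = tmap (r⊢ d2) id (θ⊢ d1);
  dibi2 : forall d1 d2,
    tmap (l⊣ d1) id (θ⊢ d2) = tmap id (l⊣ d2) (τ (θ⊢ d1));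
  dibi3 : forall d1 d2,
    tmap (r⊢ d1) id (τ (θ⊣ d2)) = tmap id (r⊢ d2) (θ⊣ d1);
  dibi4 : forall d1 d2,
    θ⊢ (d1 ⊢ d2) = tmap id (l⊢ d1) (θ⊢ d2)
                   - tmap (r⊢ d2 \- r⊣ d2) id (θ⊢ d1 - θ⊣ d1);
  dibi5 : forall d1 d2,
    θ⊢ (d1 ⊣ d2) = tmap id (l⊣ d1) (θ⊢ d2 - θ⊣ d2) + tmap (r⊣ d2) id (θ⊢ d1);
  dibi6 : forall d1 d2,
    θ⊣ (d1 ⊢ d2) = tmap id (l⊢ d1 \- l⊣ d1) (θ⊣ d2) + tmap (r⊢ d2) id (θ⊣ d1);
  dibi7 : forall d1 d2,
    θ⊣ (d1 ⊣ d2) = tmap (r⊣ d2) id (θ⊣ d1)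
                   - tmap id (l⊢ d1 \- l⊣ d1) (θ⊢ d2 - θ⊣ d2);
  dibi8 : forall d1 d2,
    tmap (l⊢ d1 \- l⊣ d1) id (θ⊢ d2) + tmap id (l⊣ d2) (τ (θ⊣ d1))
    = tmap (r⊢ d2 \- r⊣ d2) id (τ (θ⊢ d1 - θ⊣ d1)) + tmap id (r⊣ d1) (θ⊢ d2);
  dibi9 : forall d1 d2,
    tmap (r⊣ d1) id (τ (θ⊣ d2)) + tmap id (r⊢ d2) (θ⊢ d1 - θ⊣ d1)
    = tmap (l⊢ d2 \- l⊣ d2) id (θ⊢ d1 - θ⊣ d1) + tmap id (l⊢ d1) (τ (θ⊣ d2))
}.

Definition diass_YBE (r : tens D D) : tens D (tens D D) :=
  tlift (fun xi yi => tlift (fun xj yj =>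
      xi ⊗ (xj ⊗ (yi ⊢ yj)) - xj ⊗ ((xi ⊣ yj) ⊗ yi)
      - (xi ⊢ xj) ⊗ (yi ⊗ yj) + (xi ⊣ xj) ⊗ (yi ⊗ yj)) r) r.

Definition is_triangular_diass_bialgebra : Prop :=
  is_diass_bialgebra /\
  exists r : tens D D,
    [/\ τ r = r,
        diass_YBE r = 0,
        forall d, θ⊣ d = tmap id (l⊢ d \- l⊣ d) r - tmap (r⊢ d) id r
      & forall d, θ⊢ d = - (tmap (r⊢ d \- r⊣ d) id r + tmap id (l⊣ d) r)].

End Bialgebra.
End Dias.

Section Zinbiel.
Variables (k : fieldType) (B : vectType k) (m : {bilinear B -> B -> B}).
Local Notation "x ⋄ y" := (m x y) (at level 40, left associativity).

Definition is_zinbiel_algebra : Prop :=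
  forall b1 b2 b3, b1 ⋄ (b2 ⋄ b3) = (b1 ⋄ b2) ⋄ b3 + (b2 ⋄ b1) ⋄ b3.

Record is_quadratic_zinbiel (w : {skew_symmetric B}) : Prop :=
  IsQuadraticZinbiel {
  quadz_zinbiel : is_zinbiel_algebra;
  quadz_nondegenerate : nondegenerate w;
  quadz_invariant : forall b1 b2 b3,
    w (b1 ⋄ b2) b3 = w b2 (b1 ⋄ b3 + b3 ⋄ b1)
}.

(* The defining property of the coproduct of B dual to m under w; when w is
   nondegenerate it determines nu (zinbiel_dualP). *)
Definition is_zinbiel_dual (w : {skew_symmetric B})
    (nu : B -> tens B B) : Prop :=
  forall b1 b2 b3, tform w (nu b1) (b2 ⊗ b3) = w b1 (b2 ⋄ b3).

Lemma tform_pure (w : {skew_symmetric B}) (p : tens B B) b2 b3 :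
  tform w p (b2 ⊗ b3) = tlift (fun x y => w x b2 * w y b3 : k^o) p.
Proof.
apply: eq_bigr => i _; apply: eq_bigr => j _.
move: (vbasis fullv)`_i (vbasis fullv)`_j => e f.
suff -> : tlift (fun x y => w e x * w f y : k^o) (b2 ⊗ b3) = w e b2 * w f b3.
  by [].
rewrite [in RHS](coord_vbasis (memvf b2)) [in RHS](coord_vbasis (memvf b3)).
rewrite !linear_sumr mulr_suml; apply: eq_bigr => i' _.
rewrite mulr_sumr; apply: eq_bigr => j' _.
by rewrite mxE !linearZr_LR /= /GRing.scale /= mulrACA.
Qed.

Lemma zinbiel_dualP (w : {skew_symmetric B}) : nondegenerate w ->
  exists nu : {linear B -> tens B B},
    is_zinbiel_dual w nu /\
    forall nu', is_zinbiel_dual w nu' -> nu' =1 nu.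
Proof.
move=> /eqP w_nd.
have w0 u : (forall v, w u v = 0) -> u = 0.
  by move=> wu0; apply/eqP; rewrite -memv0 -w_nd; apply/mem_orthovP => v _.
have tform_linr p : linear (tform w p : tens B B -> k^o).
  by apply: (tlift_linear_param (h := fun a b => tlift _)) => *; exact: linearP.
pose e := vbasis (fullv : {vspace B}).
pose Phi (p : tens B B) : tens B B := \matrix_(i, j) tform w p (e`_i ⊗ e`_j).
have Phi_lin : linear Phi.
  by move=> a p q; apply/matrixP => i j; rewrite !mxE /tform linearP.
have tformE p t : tform w p t = \sum_i \sum_j t i j * Phi p i j.
  pose fL := GRing.isLinear.Build k (tens B B) k^o _ _ (tform_linr p).
  pose f : {linear tens B B -> k^o} := HB.pack (tform w p) fL.
  rewrite -[tform w p]/(f : _ -> _) [in LHS](tens_coordE t) linear_sum.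
  apply: eq_bigr => i _; rewrite linear_sum; apply: eq_bigr => j _.
  by rewrite linearZ mxE.
have e_free : free e := basis_free (vbasisP _).
have Phi_ker p : Phi p = 0 -> p = 0.
  move=> Phi0; have p0 b3 : forall i, \sum_j p i j * w e`_j b3 = 0.
    apply: (freeP e_free (fun i => \sum_j p i j * w e`_j b3)).
    apply: w0 => b2.
    rewrite linear_sumlz -[RHS](_ : tform w p (b2 ⊗ b3) = 0).
      rewrite tform_pure; apply: eq_bigr => i _.
      rewrite linearZl_LR /= mulr_suml; apply: eq_bigr => j _.
      by rewrite /GRing.scale /= -mulrA [in RHS](mulrC (w _ b2)).
    rewrite tformE Phi0 big1 // => i _; rewrite big1 // => j _.
    by rewrite !mxE mulr0.
  apply/matrixP => i j; rewrite mxE.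
  apply: (freeP e_free (p i)); apply: w0 => b3.
  rewrite linear_sumlz -[RHS](p0 b3 i); apply: eq_bigr => j' _.
  by rewrite linearZl_LR.
pose PhiLin := GRing.isLinear.Build k (tens B B) (tens B B) _ Phi Phi_lin.
pose PhiL : {linear tens B B -> tens B B} := HB.pack Phi PhiLin.
have PhiE p : linfun PhiL p = Phi p by rewrite lfunE.
have ker0 : lker (linfun PhiL) == 0%VS.
  rewrite -subv0; apply/subvP => p; rewrite memv_ker PhiE => /eqP/Phi_ker->.
  exact: mem0v.
have dualE nu b1 b2 b3 : Phi (nu b1) = \matrix_(i, j) w b1 (e`_i ⋄ e`_j) ->
    tform w (nu b1) (b2 ⊗ b3) = w b1 (b2 ⋄ b3).
  move=> Phi_nu; rewrite tformE Phi_nu.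
  rewrite [in RHS](coord_vbasis (memvf b2)) [in RHS](coord_vbasis (memvf b3)).
  rewrite linear_sumlz linear_sumr; apply: eq_bigr => i _.
  rewrite !linear_sumr; apply: eq_bigr => j _.
  by rewrite linearZl_LR linearZr_LR !linearZr_LR !mxE /= mulrA.
pose nu b1 : tens B B :=
  (linfun PhiL)^-1%VF (\matrix_(i, j) w b1 (e`_i ⋄ e`_j)).
have nu_lin : linear nu.
  move=> a b b'; rewrite /nu -linearP; congr (_ _).
  by apply/matrixP => i j; rewrite !mxE linearPl.
pose nuLin := GRing.isLinear.Build k B (tens B B) _ nu nu_lin.
exists (HB.pack nu nuLin : {linear B -> tens B B}).
split=> [b1 b2 b3 | nu' nu'P b1].
  by apply: dualE; rewrite -PhiE lker0_lfunVK.
rewrite -[LHS](lker0_lfunK ker0) PhiE; congr (_ _).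
by apply/matrixP => i j; rewrite !mxE nu'P.
Qed.

End Zinbiel.

Section ASI.
Variables (k : fieldType) (A : vectType k).
Variables (m : {bilinear A -> A -> A}) (Delta : {linear A -> tens A A}).
Local Notation "x ⋅ y" := (m x y) (at level 40, left associativity).
Local Notation "'lA' a" := (m a) (at level 10, a at level 9).
Local Notation "'rA' a" := (fun x => x ⋅ a) (at level 10, a at level 9).
Local Notation τ := (@tswap k A A).

Record is_ASI_bialgebra : Prop := IsASIBialgebra {
  asi_mulA : forall a1 a2 a3, (a1 ⋅ a2) ⋅ a3 = a1 ⋅ (a2 ⋅ a3);
  asi_comulA : forall a,
    tassoc (tmap Delta id (Delta a)) = tmap id Delta (Delta a);
  asi_comulM : forall a1 a2,
    Delta (a1 ⋅ a2) = tmap (rA a2) id (Delta a1) + tmap id (lA a1) (Delta a2);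
  asi_antisym : forall a1 a2,
    tmap (lA a1) id (Delta a2) - tmap id (rA a1) (Delta a2)
    = τ (tmap id (rA a2) (Delta a1) - tmap (lA a2) id (Delta a1))
}.

Definition assoc_YBE (s : tens A A) : tens A (tens A A) :=
  tlift (fun ui vi => tlift (fun uj vj =>
      (ui ⋅ uj) ⊗ (vi ⊗ vj) + ui ⊗ (uj ⊗ (vi ⋅ vj))
      - uj ⊗ ((ui ⋅ vj) ⊗ vi)) s) s.

Definition is_triangular_ASI_bialgebra : Prop :=
  is_ASI_bialgebra /\
  exists s : tens A A,
    [/\ τ s = - s,
        assoc_YBE s = 0
      & forall a, Delta a = tmap id (lA a) s - tmap (rA a) id s].

End ASI.

Section DiassZinbiel.
Variables (k : fieldType) (D B : vectType k).
Variables (dl dr : {bilinear D -> D -> D}) (m : {bilinear B -> B -> B}).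
Variables (tl tr : {linear D -> tens D D}) (nu : {linear B -> tens B B}).

Definition dzmul (x y : tens D B) : tens D B :=
  tlift (fun d1 b1 => tlift (fun d2 b2 =>
    dr d1 d2 ⊗ m b1 b2 + dl d1 d2 ⊗ m b2 b1) y) x.

Definition dzcomul : tens D B -> tens (tens D B) (tens D B) :=
  tlift (fun d b => tr d • nu b + tl d • tswap (nu b)).

HB.instance Definition _ := GRing.Linear.on dzcomul.

Fact dzmul_is_bilinear :
  @bilinear_for k (tens D B) (tens D B) (tens D B) *:%R *:%R dzmul.
Proof.
split=> [y a x x' | x a y y']; first exact: linearP.
by apply: (tlift_linear_param (h := fun d1 b1 => tlift _)) => *; exact: linearP.
Qed.

HB.instance Definition _ :=
  bilinear_isBilinear.Build k (tens D B) (tens D B) (tens D B) *:%R *:%R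
    dzmul dzmul_is_bilinear.

Lemma dzmulE d1 b1 d2 b2 :
  dzmul (d1 ⊗ b1) (d2 ⊗ b2) = dr d1 d2 ⊗ m b1 b2 + dl d1 d2 ⊗ m b2 b1.
Proof.
have E d b : tlift (fun d2 b2 => dr d d2 ⊗ m b b2 + dl d d2 ⊗ m b2 b) (d2 ⊗ b2)
    = dr d d2 ⊗ m b b2 + dl d d2 ⊗ m b2 b.
  apply: tliftE; split=> [b' a x y | d' a x y] /=.
    by rewrite !linearPr !linearPl scalerDr addrACA.
  by rewrite linearPr linearPl !linearPr scalerDr addrACA.
rewrite /dzmul tliftE ?E //; split=> [b' a x y | d' a x y] /=.
  by rewrite !E !(linearPl, linearPr) scalerDr addrACA.
by rewrite !E !(linearPl, linearPr) scalerDr addrACA.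
Qed.

Lemma dzcomulE d b :
  dzcomul (d ⊗ b) = tr d • nu b + tl d • tswap (nu b).
Proof.
have bulletPr p : linear (@tbullet k D B p).
  by apply: (tlift_linear_param (h := fun x y => tlift _)) => *; exact: linearP.
have bulletPl q : linear (fun p => @tbullet k D B p q).
  by move=> a x y; exact: linearP.
apply: tliftE; split; [move=> b' a x y | move=> d' a x y] => /=.
  by rewrite !linearP !bulletPl scalerDr addrACA.
by rewrite !linearP !bulletPr scalerDr addrACA.
Qed.

End DiassZinbiel.

(* Main.v *)
(* The evaluations [ev x (d ⊗ b) = w b x *: d] separate the points of D ⊗ B, so an
   identity in (D ⊗ B) ⊗ (D ⊗ B) may be checked in D ⊗ D after applying
   [tmap (ev x) (ev y)] for all x, y. There the invariance of w and the Zinbiel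
   identity bring every scalar to the form [w b1 (m (m _ _) _)], and the
   coefficients of the resulting scalars vanish by the axioms of D.
   In the triangular case, let q in B ⊗ B be the element dual to -w. Then
   s = r • q is skew-symmetric, and the test of its associative Yang-Baxter
   tensor against x, y, z is a combination of the diassociative Yang-Baxter
   tensor of r and of a cyclic permutation of it, with coefficients
   [w (m x y) z] and [w (m y x) z]. *)
Require Import Defs.
From HB Require Import structures.
From mathcomp Require Import all_boot all_order all_algebra.
From mathcomp Require Import ring.

Set Implicit Arguments.
Unset Strict Implicit.
Unset Printing Implicit Defensive.

Import GRing.Theory.
Local Open Scope ring_scope.

(** * Calculus of [tmap], [tswap], [tassoc] and the bullet product *)

Section TensorMaps.
Variable k : fieldType.
Implicit Types U V W X Y Z : vectType k.

(** A scalar is absorbed into the left factor of a pure tensor and 0 is [0 ⊗ 0], so closure under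
    sums reaches every tensor. *)
Lemma tens_ind U V (P : tens U V -> Prop) :
  (forall u v, P (u ⊗ v)) -> (forall s t, P s -> P t -> P (s + t)) ->
  forall t, P t.
Proof.
move=> Pp PD t; rewrite (tens_coordE t).
have P0 : P 0 by rewrite -(linear0l (@tpure k U V) 0); exact: Pp.
apply: big_ind => // i _; apply: big_ind => // j _.
by rewrite -linearZl_LR; exact: Pp.
Qed.

Lemma tens_sum U V (t : tens U V) :
  exists s : seq (U * V), t = \sum_(p <- s) p.1 ⊗ p.2.
Proof.
elim/tens_ind: t => [u v | t1 t2 [s1 ->] [s2 ->]].
  by exists [:: (u, v)]; rewrite big_seq1.
by exists (s1 ++ s2); rewrite big_cat.
Qed.

Lemma tlift_sumE U V X (f : U -> V -> X) (s : seq (U * V)) :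
  bilinear_for *:%R *:%R f ->
  tlift f (\sum_(p <- s) p.1 ⊗ p.2) = \sum_(p <- s) f p.1 p.2.
Proof.
by move=> f_bil; rewrite linear_sum /=; apply: eq_bigr => p _; rewrite tliftE.
Qed.

Lemma tmapE U V X Y (f : {linear U -> X}) (g : {linear V -> Y}) u v :
  tmap f g (u ⊗ v) = f u ⊗ g v.
Proof.
rewrite /tmap tliftE //; split=> [v' | u'] a x y /=.
  by rewrite linearP linearPl.
by rewrite linearP linearPr.
Qed.

Lemma eq_tmap U V X Y (f f' : U -> X) (g g' : V -> Y) :
  f =1 f' -> g =1 g' -> tmap f g =1 tmap f' g'.
Proof.
move=> ff gg t; apply: eq_bigr => i _; apply: eq_bigr => j _.
by rewrite ff gg.
Qed.

(** Stated for plain functions, because [tmap] evaluates them on basis vectors only; this covers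
    right multiplications written [fun x => dl x d]. *)
Lemma tmapDl U V X Y (f f' : U -> X) (g : V -> Y) t :
  tmap (f \+ f') g t = tmap f g t + tmap f' g t.
Proof.
rewrite /tmap /tlift -big_split; apply: eq_bigr => i _.
rewrite -big_split; apply: eq_bigr => j _ /=.
by rewrite linearDl scalerDr.
Qed.

Lemma tmapDr U V X Y (f : U -> X) (g g' : V -> Y) t :
  tmap f (g \+ g') t = tmap f g t + tmap f g' t.
Proof.
rewrite /tmap /tlift -big_split; apply: eq_bigr => i _.
rewrite -big_split; apply: eq_bigr => j _ /=.
by rewrite linearDr scalerDr.
Qed.

Lemma tmapNl U V X Y (f : U -> X) (g : V -> Y) t :
  tmap (\- f) g t = - tmap f g t.
Proof.
rewrite /tmap /tlift -sumrN; apply: eq_bigr => i _.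
rewrite -sumrN; apply: eq_bigr => j _ /=.
by rewrite linearNl scalerN.
Qed.

Lemma tmapNr U V X Y (f : U -> X) (g : V -> Y) t :
  tmap f (\- g) t = - tmap f g t.
Proof.
rewrite /tmap /tlift -sumrN; apply: eq_bigr => i _.
rewrite -sumrN; apply: eq_bigr => j _ /=.
by rewrite linearNr scalerN.
Qed.

Lemma tmapBl U V X Y (f f' : U -> X) (g : V -> Y) t :
  tmap (f \- f') g t = tmap f g t - tmap f' g t.
Proof. by rewrite -tmapNl -tmapDl. Qed.

Lemma tmapBr U V X Y (f : U -> X) (g g' : V -> Y) t :
  tmap f (g \- g') t = tmap f g t - tmap f g' t.
Proof. by rewrite -tmapNr -tmapDr. Qed.

(** The outer maps are linear so that [tmapE] applies to the pure tensors formed by [f'] and [g'] on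
    the bases. *)
Lemma tmap_comp U V U' V' X Y (f : {linear U' -> X}) (g : {linear V' -> Y})
    (f' : U -> U') (g' : V -> V') t :
  tmap f g (tmap f' g' t) = tmap (f \o f') (g \o g') t.
Proof.
rewrite {2 3}/tmap /tlift linear_sum; apply: eq_bigr => i _.
by rewrite linear_sum; apply: eq_bigr => j _; rewrite linearZ /= tmapE.
Qed.

Lemma tswapE U V (u : U) (v : V) : tswap (u ⊗ v) = v ⊗ u.
Proof.
rewrite /tswap tliftE //; split=> [v' | u'] a x y /=.
  by rewrite linearPr.
by rewrite linearPl.
Qed.

Lemma tswapK U V : cancel (@tswap k U V) (@tswap k V U).
Proof.
by elim/tens_ind => [u v | s t Hs Ht]; rewrite ?linearD /= ?tswapE // Hs Ht.
Qed.

Lemma tassocE U V W (u : U) (v : V) (w : W) :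
  tassoc ((u ⊗ v) ⊗ w) = u ⊗ (v ⊗ w).
Proof.
have E v' w' : tlift (fun a b => a ⊗ (b ⊗ w')) (u ⊗ v') = u ⊗ (v' ⊗ w').
  rewrite tliftE //; split=> [b | b] a x y /=; first by rewrite linearPl.
  by rewrite linearPl linearPr.
rewrite /tassoc tliftE ?E //; split=> [w' | t] a x y /=.
  by rewrite linearP.
by apply: (tlift_linear_param (h := fun a b c => a ⊗ (b ⊗ c))) => u' v' c p q;
  rewrite !linearPr.
Qed.

Lemma tmap_tassoc U V W X Y Z (f : {linear U -> X}) (g : {linear V -> Y})
    (h : {linear W -> Z}) t :
  tmap f (tmap g h) (tassoc t) = tassoc (tmap (tmap f g) h t).
Proof.
elim/tens_ind: t => [t w | s t Hs Ht]; last by rewrite !linearD /= Hs Ht.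
elim/tens_ind: t => [u v | s t Hs Ht].
  by rewrite tassocE !tmapE /= !tmapE tassocE.
by rewrite !(linearDl, linearD) /= Hs Ht.
Qed.

Lemma tswap_tmap U V X Y (f : {linear U -> X}) (g : {linear V -> Y}) t :
  tswap (tmap f g t) = tmap g f (tswap t).
Proof.
elim/tens_ind: t => [u v | s t Hs Ht]; first by rewrite tmapE !tswapE tmapE.
by rewrite !linearD /= Hs Ht.
Qed.

Section Bullet.
Variables D B : vectType k.
Implicit Types (p : tens D D) (q : tens B B).

Fact tbullet_is_bilinear :
  @bilinear_for k _ _ (tens (tens D B) (tens D B)) *:%R *:%R (@tbullet k D B).
Proof.
split=> [q a x y | p a x y]; first exact: linearP.
by apply: (tlift_linear_param (h := fun x y => tlift _)) => *; exact: linearP.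
Qed.

HB.instance Definition _ :=
  bilinear_isBilinear.Build k (tens D D) (tens B B) (tens (tens D B) (tens D B))
    *:%R *:%R (@tbullet k D B) tbullet_is_bilinear.

Lemma tbulletE (d d' : D) (b b' : B) :
  (d ⊗ d') • (b ⊗ b') = (d ⊗ b) ⊗ (d' ⊗ b').
Proof.
have E d1 d2 :
    tlift (fun b b' => (d1 ⊗ b) ⊗ (d2 ⊗ b')) (b ⊗ b') = (d1 ⊗ b) ⊗ (d2 ⊗ b').
  by rewrite tliftE //; split=> ? ? ? ? /=; rewrite !(linearPl, linearPr).
rewrite /tbullet tliftE ?E //.
by split=> ? ? ? ? /=; rewrite !E !(linearPl, linearPr).
Qed.

End Bullet.
End TensorMaps.

Section TmapLinear.
Variables (k : fieldType) (U V X Y : vectType k) (f : U -> X) (g : V -> Y).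
Implicit Types s t : tens U V.

(** Linearity specialized to [tmap] and [tswap]: rewriting with these lemmas leaves the other linear
    maps of a goal alone. *)
Lemma tmapD s t : tmap f g (s + t) = tmap f g s + tmap f g t.
Proof. exact: linearD. Qed.

Lemma tmapN t : tmap f g (- t) = - tmap f g t.
Proof. exact: linearN. Qed.

Lemma tmapZ a t : tmap f g (a *: t) = a *: tmap f g t.
Proof. exact: linearZ. Qed.

Lemma tswapD s t : tswap (s + t) = tswap s + tswap t.
Proof. exact: linearD. Qed.

Lemma tswapN t : tswap (- t) = - tswap t.
Proof. exact: linearN. Qed.

Lemma tswapZ a t : tswap (a *: t) = a *: tswap t.
Proof. exact: linearZ. Qed.

End TmapLinear.

(** Once each [tmap] tensor and each scalar [w b x] is an opaque variable, a tensor identity is a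
    ring identity between matrix entries. *)
Ltac tensor_ring b :=
  repeat match goal with
  | |- context [tmap ?f ?g ?t] => move: (tmap f g t) => ?
  end;
  repeat match goal with |- context [?F b ?x] => move: (F b x) => ? end;
  apply/matrixP => ? ?; rewrite !mxE; ring.

(** * Separating families of linear maps *)

Section Separating.
Variable k : fieldType.
Implicit Types U V X Y : vectType k.

(* A family of maps with a finite joint retraction: unlike joint injectivity,
   this property passes directly to tensor products. *)
Definition separating U X (I : Type) (f : I -> U -> X) : Prop :=
  exists s : seq (I * {linear X -> U}), forall u, u = \sum_(p <- s) p.2 (f p.1 u).

Lemma separating_inj U X I (f : I -> U -> X) u v :
  separating f -> (forall i, f i u = f i v) -> u = v.
Proof.
by case=> s sE fuv; rewrite (sE u) (sE v); apply: eq_bigr => p _; rewrite fuv.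
Qed.

(** The tensor products of the two families of retractions retract the family of tensor products. *)
Lemma separating_tmap U V X Y I J
    (f : I -> {linear U -> X}) (g : J -> {linear V -> Y}) :
  separating f -> separating g ->
  separating (fun p : I * J => tmap (f p.1) (g p.2)).
Proof.
case=> s sE [r rE].
pose h (p : I * {linear X -> U}) (q : J * {linear Y -> V}) :=
  ((p.1, q.1), tmap p.2 q.2 : {linear tens X Y -> tens U V}).
exists [seq h p q | p <- s, q <- r].
elim/tens_ind => [u v | t1 t2 E1 E2]; last first.
  rewrite {1}E1 {1}E2 -big_split; apply: eq_bigr => p _ /=.
  by rewrite !linearD.
rewrite big_allpairs_dep {1}(sE u) {1}(rE v) linear_sumlz.
apply: eq_bigr => p _; rewrite linear_sumr; apply: eq_bigr => q _.
by rewrite /= !tmapE.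
Qed.

End Separating.

(** * Dual bases and the copairing of a nondegenerate skew form *)

Section Form.
Variables (k : fieldType) (B : vectType k) (w : {skew_symmetric B}).

Lemma skewC x y : w x y = - w y x.
Proof. by rewrite [LHS]hermC /= expr1 mulN1r. Qed.

Lemma tform_tpure a b x y : tform w (a ⊗ b) (x ⊗ y) = w a x * w b y.
Proof.
rewrite tform_pure tliftE //; split=> [b' | a'] c u v /=.
  by rewrite linearPl /= mulrDl /GRing.scale /= mulrA.
by rewrite linearPl /= mulrDr /GRing.scale /= mulrCA.
Qed.

Lemma tformD p q t : tform w (p + q) t = tform w p t + tform w q t.
Proof. by rewrite /tform linearD. Qed.

Lemma tform_tswap q x y : tform w (tswap q) (x ⊗ y) = tform w q (y ⊗ x).
Proof.
elim/tens_ind: q => [a b | s t Hs Ht]; first by rewrite tswapE !tform_tpure mulrC.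
by rewrite linearD /= !tformD Hs Ht.
Qed.

Hypothesis w_nd : nondegenerate w.

Lemma nondegenerate_eq0 u : (forall v, w u v = 0) -> u = 0.
Proof.
move=> wu0; apply/eqP; rewrite -memv0 -(eqP w_nd).
by apply/mem_orthovP => v _.
Qed.

Lemma nondegenerate_dual_basis : let e := vbasis (fullv : {vspace B}) in
  exists e' : 'I_(\dim (fullv : {vspace B})) -> B,
    forall b, b = \sum_j w b (e' j) *: e`_j.
Proof.
move=> e; have e_free : free e := basis_free (vbasisP _).
pose n := \dim (fullv : {vspace B}).
pose G : 'M_n := \matrix_(i, j) w e`_i e`_j.
(* A row vector killed by the Gram matrix is the coordinate vector of an element orthogonal to the
   whole basis, hence zero. *)
have G_unit : G \in unitmx.
  rewrite -row_free_unit; apply: inj_row_free => v vG.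
  suff v0 : \sum_i v 0 i *: e`_i = 0.
    by apply/rowP => i; rewrite mxE; apply: (freeP e_free (v 0) v0).
  apply: nondegenerate_eq0 => b; rewrite (coord_vbasis (memvf b)) linear_sumr.
  rewrite big1 // => j _.
  rewrite linearZr_LR /= linear_sumlz.
  suff -> : \sum_i w (v 0 i *: e`_i) e`_j = 0 by rewrite mulr0.
  move/rowP/(_ j): vG; rewrite !mxE; apply: etrans.
  by apply: eq_bigr => i _; rewrite mxE linearZl_LR.
(* The columns of the inverse Gram matrix give the basis dual to [e]. *)
pose e' j := \sum_l invmx G l j *: e`_l.
have we' (i j : 'I_n) : w e`_i (e' j) = (i == j)%:R.
  have /matrixP/(_ i j) := mulmxV G_unit; rewrite !mxE => <-.
  by rewrite linear_sumr; apply: eq_bigr => l _; rewrite mxE linearZr_LR mulrC.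
exists e' => b.
rewrite {1}(coord_vbasis (memvf b)); apply: eq_bigr => j _; congr (_ *: _).
rewrite [in RHS](coord_vbasis (memvf b)) linear_sumlz (bigD1 j) //=.
rewrite linearZl_LR /= -/e; rewrite we' eqxx mulr1 big1 ?addr0 // => i /negPf ij.
by rewrite linearZl_LR /= we' ij mulr0.
Qed.

(** The canonical tensor of a basis and its dual basis; the sign comes from skewness in the first
    leg. It is the sign for which the coboundary of [r • q] is the coproduct itself and not its
    negative. *)
Lemma nondegenerate_copairing :
  exists q : tens B B, forall x y, tform w q (x ⊗ y) = - w x y.
Proof.
have [e' e'E] := nondegenerate_dual_basis.
exists (\sum_j e' j ⊗ (vbasis fullv)`_j) => x y.
rewrite {2}(e'E x) linear_sumlz -sumrN.
rewrite (big_morph (fun q => tform w q _) (fun p q => tformD p q _) (id1 := 0)).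
  by apply: eq_bigr => j _; rewrite tform_tpure linearZl_LR /= skewC mulNr.
by rewrite /tform linear0.
Qed.

End Form.

(** * Evaluation maps from [tens D B] to [D] *)

Section Evaluation.
Variables (k : fieldType) (D B : vectType k) (w : {skew_symmetric B}).

Definition ev (x : B) : tens D B -> D := tlift (fun d b => w b x *: d).

HB.instance Definition _ x := GRing.Linear.on (ev x).

Lemma evE x d b : ev x (d ⊗ b) = w b x *: d.
Proof.
rewrite /ev tliftE //; split=> [b' | d'] a u v /=.
  by rewrite linearP.
by rewrite linearPl /= scalerDl scalerA.
Qed.

Lemma ev_tbullet x y p q : tmap (ev x) (ev y) (p • q) = tform w q (x ⊗ y) *: p.
Proof.
elim/tens_ind: p => [d d' | s t Hs Ht]; last first.
  by rewrite linearDl linearD /= Hs Ht scalerDr.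
elim/tens_ind: q => [b b' | s t Hs Ht].
  by rewrite tbulletE tform_tpure tmapE /= !evE linearZl_LR linearZr_LR /= scalerA.
by rewrite linearDr linearD /= Hs Ht tformD scalerDl.
Qed.

Hypothesis w_nd : nondegenerate w.

(** Expanding [b] by the dual basis gives [d ⊗ b] as the sum of [ev (e' j) (d ⊗ b) ⊗ e_j], so the
    maps sending [d] to [d ⊗ e_j] are retractions. *)
Lemma separating_ev : separating ev.
Proof.
have [e' e'E] := nondegenerate_dual_basis w_nd.
pose h j : B * {linear D -> tens D B} :=
  (e' j, applyr (@tpure k D B) (vbasis fullv)`_j : {linear _ -> _}).
exists [seq h j | j <- index_enum _].
elim/tens_ind => [d b | s t Hs Ht]; rewrite big_map.
  rewrite {1}(e'E b) linear_sumr; apply: eq_bigr => j _ /=.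
  by rewrite /applyr evE linearZr_LR linearZl_LR.
move: Hs Ht; rewrite !big_map => Hs Ht; rewrite {1}Hs {1}Ht -big_split.
by apply: eq_bigr => j _ /=; rewrite -linearDl -linearD.
Qed.

End Evaluation.

(** * Invariance identities of a quadratic Zinbiel algebra *)

Section QuadraticZinbiel.
Variables (k : fieldType) (B : vectType k) (m : {bilinear B -> B -> B}).
Variables (w : {skew_symmetric B}) (B_quad : is_quadratic_zinbiel m w).

Lemma quadz_invl a b c : w (m a b) c = w b (m a c) + w b (m c a).
Proof. by rewrite (quadz_invariant B_quad) linearDr. Qed.

(** Invariance and skewness give [w (m x y) z + w (m x z) y + w (m z x) y = 0]. Two instances of
    this share two terms; comparing the third ones gives [w (m a b) c = w (m c b) a]. *)
Lemma quadz_invr a b c : w (m a b) c = - w a (m c b).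
Proof.
have H x y z : w (m x y) z = - w (m x z) y - w (m z x) y.
  by rewrite quadz_invl (skewC w y) (skewC w y (m z x)).
have : w (m a b) c = w (m c b) a.
  have h1 := H b c a; have h2 := H b a c.
  apply: (addrI (w (m b c) a + w (m b a) c)); transitivity (0 : k).
    by rewrite {1}h1; ring.
  by rewrite h2; ring.
by move=> ->; rewrite skewC.
Qed.

Lemma quadz_mull c a b : w c (m a b) = w a (m c b).
Proof. by rewrite skewC quadz_invr opprK. Qed.

Lemma quadz_mulr c a b : w c (m a b) = - w b (m a c) - w b (m c a).
Proof. by rewrite skewC quadz_invl opprD. Qed.

End QuadraticZinbiel.

(** * Evaluation of products and coproducts *)

Section DiassZinbiel.
Variables (k : fieldType) (D B : vectType k).
Variables (dl dr : {bilinear D -> D -> D}) (m : {bilinear B -> B -> B}).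
Variables (tl tr : {linear D -> tens D D}) (nu : {linear B -> tens B B}).
Variables (w : {skew_symmetric B}) (B_quad : is_quadratic_zinbiel m w).
Hypothesis nu_dual : is_zinbiel_dual m w nu.

Local Notation mul := (dzmul dl dr m).
Local Notation Delta := (dzcomul tl tr nu).
Local Notation ev := (@ev k D B w).

(** Invariance moves the factor [b] across [w], so multiplication by [d ⊗ b] becomes multiplication
    by [d] after a change of evaluation point. *)
Lemma ev_dzmulr x d b t :
  ev x (mul t (d ⊗ b)) =
  dl (ev (m b x) t + ev (m x b) t) d - dr (ev (m x b) t) d.
Proof.
elim/tens_ind: t => [d' b' | s t Hs Ht]; last first.
  by rewrite linearDl linearD /= Hs Ht !linearD /= !linearDl !opprD addrACA;
  congr (_ + _); rewrite addrACA.
rewrite dzmulE linearD /= !evE quadz_invr // quadz_invl //.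
by rewrite !linearDl !linearZl_LR /= scalerDl scaleNr addrC.
Qed.

Lemma ev_dzmull x d b t :
  ev x (mul (d ⊗ b) t) =
  dr d (ev (m b x) t + ev (m x b) t) - dl d (ev (m x b) t).
Proof.
elim/tens_ind: t => [d' b' | s t Hs Ht]; last first.
  by rewrite linearDr linearD /= Hs Ht !linearD /= addrACA;
  congr (_ + _); rewrite addrACA.
rewrite dzmulE linearD /= !evE (quadz_invl B_quad) (quadz_invr B_quad).
by rewrite !linearDr !linearZr_LR /= scalerDl scaleNr.
Qed.

Lemma ev_dzcomul x y d b :
  tmap (ev x) (ev y) (Delta (d ⊗ b)) =
  w b (m x y) *: tr d + w b (m y x) *: tl d.
Proof. by rewrite dzcomulE linearD /= !ev_tbullet tform_tswap !nu_dual. Qed.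

(** The scalars of [ev_dzcomul] are absorbed into the evaluation points. This form is linear in [t],
    as iterating the coproduct requires. *)
Lemma ev_dzcomul_lin x y t :
  tmap (ev x) (ev y) (Delta t) = tr (ev (m x y) t) + tl (ev (m y x) t).
Proof.
elim/tens_ind: t => [d b | s t Hs Ht]; last first.
  by rewrite !linearD /= Hs Ht addrACA.
by rewrite ev_dzcomul !evE !linearZ.
Qed.

End DiassZinbiel.

(** * The two compatibility conditions on pure tensors *)

Section Compatibility.
Variables (k : fieldType) (D B : vectType k).
Variables (dl dr : {bilinear D -> D -> D}) (m : {bilinear B -> B -> B}).
Variables (tl tr : {linear D -> tens D D}) (nu : {linear B -> tens B B}).
Variables (w : {skew_symmetric B}) (B_quad : is_quadratic_zinbiel m w).
Hypothesis nu_dual : is_zinbiel_dual m w nu.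

Local Notation mul := (dzmul dl dr m).
Local Notation Delta := (dzcomul tl tr nu).
Local Notation ev := (@ev k D B w).

(** This lemma and the next three apply [ev_dzmulr] or [ev_dzmull] in one leg of a tensor. *)
Lemma ev_mulr_id x y d b T :
  tmap (ev x) (ev y) (tmap (fun t => mul t (d ⊗ b)) id T) =
    tmap (fun e => dl e d) id
      (tmap (ev (m b x)) (ev y) T + tmap (ev (m x b)) (ev y) T)
    - tmap (fun e => dr e d) id (tmap (ev (m x b)) (ev y) T).
Proof.
(* [applyr dl d] is right multiplication by [d] carrying its linear structure, which [tmap_comp]
   asks of the outer map. *)
have := tmap_comp (applyr dl d) idfun; have := tmap_comp (applyr dr d) idfun.
rewrite /applyr_head => Er El; rewrite linearD /= !El !Er tmap_comp -tmapDl -tmapBl.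
apply: eq_tmap => // t /=.
by rewrite ev_dzmulr // linearDl.
Qed.

Lemma ev_id_mulr x y d b T :
  tmap (ev x) (ev y) (tmap id (fun t => mul t (d ⊗ b)) T) =
    tmap id (fun e => dl e d)
      (tmap (ev x) (ev (m b y)) T + tmap (ev x) (ev (m y b)) T)
    - tmap id (fun e => dr e d) (tmap (ev x) (ev (m y b)) T).
Proof.
have := tmap_comp idfun (applyr dl d); have := tmap_comp idfun (applyr dr d).
rewrite /applyr_head => Er El; rewrite linearD /= !El !Er tmap_comp -tmapDr -tmapBr.
apply: eq_tmap => // t /=.
by rewrite ev_dzmulr // linearDl.
Qed.

Lemma ev_mull_id x y d b T :
  tmap (ev x) (ev y) (tmap (mul (d ⊗ b)) id T) =
    tmap (dr d) id (tmap (ev (m b x)) (ev y) T + tmap (ev (m x b)) (ev y) T)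
    - tmap (dl d) id (tmap (ev (m x b)) (ev y) T).
Proof.
have := tmap_comp (dl d) idfun; have := tmap_comp (dr d) idfun.
move=> /= Er El; rewrite linearD /= !El !Er tmap_comp -tmapDl -tmapBl.
apply: eq_tmap => // t /=.
by rewrite ev_dzmull // linearD.
Qed.

Lemma ev_id_mull x y d b T :
  tmap (ev x) (ev y) (tmap id (mul (d ⊗ b)) T) =
    tmap id (dr d) (tmap (ev x) (ev (m b y)) T + tmap (ev x) (ev (m y b)) T)
    - tmap id (dl d) (tmap (ev x) (ev (m y b)) T).
Proof.
have := tmap_comp idfun (dl d); have := tmap_comp idfun (dr d).
move=> /= Er El; rewrite linearD /= !El !Er tmap_comp -tmapDr -tmapBr.
apply: eq_tmap => // t /=.
by rewrite ev_dzmull // linearD.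
Qed.

Hypothesis D_bialg : is_diass_bialgebra dl dr tl tr.

Local Notation ev_mulE :=
  (ev_mulr_id, ev_id_mulr, ev_mull_id, ev_id_mull, ev_dzcomul _ _ nu_dual).

(** [dibi4] to [dibi7] expand the coproducts of the products in [D], and [dibi1] identifies two of
    the tensors that result. *)
Lemma dzcomul_mul_pure d1 b1 d2 b2 x y :
  tmap (ev x) (ev y) (Delta (mul (d1 ⊗ b1) (d2 ⊗ b2))) =
  tmap (ev x) (ev y) (tmap (fun t => mul t (d2 ⊗ b2)) id (Delta (d1 ⊗ b1))
    + tmap id (mul (d1 ⊗ b1)) (Delta (d2 ⊗ b2))).
Proof.
have zin := quadz_zinbiel B_quad.
have wD u v : w b1 (u + v) = w b1 u + w b1 v by exact: linearDr.
rewrite dzmulE !linearD /= !ev_mulE.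
(* Invariance isolates [b1] in the first argument of [w]. Bracketing the second argument to the left
   by [zin] leaves at most six scalars, one for each order of [b2], [x] and [y]. *)
rewrite !(quadz_invr B_quad b1) !(quadz_invl B_quad b2).
rewrite !(quadz_mull B_quad b2 (m _ _)) !(quadz_mulr B_quad b2 x).
rewrite !(quadz_invr B_quad b1) !(quadz_invl B_quad y) !zin.
rewrite (dibi4 D_bialg) (dibi5 D_bialg) (dibi6 D_bialg) (dibi7 D_bialg).
rewrite !tmapBl !tmapBr ?(tmapD, tmapN, tmapZ) ?wD ?(dibi1 D_bialg).
tensor_ring b1.
Qed.

(** No coproduct of a product occurs here, so the identities that enter are [dibi2], [dibi3],
    [dibi8] and [dibi9], the last one both directly and flipped. *)
Lemma dzcomul_antisym_pure d1 b1 d2 b2 x y :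
  tmap (ev x) (ev y) (tmap (mul (d1 ⊗ b1)) id (Delta (d2 ⊗ b2))
    - tmap id (fun t => mul t (d1 ⊗ b1)) (Delta (d2 ⊗ b2))) =
  tmap (ev x) (ev y) (tswap
    (tmap id (fun t => mul t (d2 ⊗ b2)) (Delta (d1 ⊗ b1))
    - tmap (mul (d2 ⊗ b2)) id (Delta (d1 ⊗ b1)))).
Proof.
have zin := quadz_zinbiel B_quad.
have wD u v : w b1 (u + v) = w b1 u + w b1 v by exact: linearDr.
have tswap_l (f : {linear D -> D}) := @tswap_tmap k D D D D f idfun.
have tswap_r (f : {linear D -> D}) := @tswap_tmap k D D D D idfun f.
have sl2 := tswap_l (dl d2); have sr2 := tswap_l (dr d2).
have sl2' := tswap_r (applyr dl d2); have sr2' := tswap_r (applyr dr d2).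
rewrite /applyr_head /= in sl2 sr2 sl2' sr2'.
(* Identity (8), identity (9) with d1 and d2 exchanged, and the flip of identity
   (9), each solved for one term. *)
have e8 := canRL (addKr _) (esym (dibi8 D_bialg d1 d2)).
have e9 := canRL (addrK _) (dibi9 D_bialg d2 d1).
have e9' := congr1 (@tswap k D D) (dibi9 D_bialg d1 d2).
have slr := tswap_l (applyr dl d1); have srr := tswap_r (dr d1).
have srr' := tswap_r (applyr dr d2); rewrite /applyr_head /= in slr srr srr'.
rewrite !tmapBl !(tswapD, tswapN, tmapD, tmapN) in e9'.
rewrite !slr ?srr ?srr' ?sl2 ?sr2 !tswapK in e9'.
have {}e9' := canLR (subrK _) (canLR (subrK _) (canLR (addrK _) e9')).
(* The flip moves outside the evaluations and exchanges [x] and [y]; it then acts on [tens D D]. *)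
rewrite -tswap_tmap !(tmapD, tmapN) /= !ev_mulE.
rewrite !(quadz_mull B_quad b2 (m _ _)) !(quadz_mulr B_quad b2 x).
rewrite !(quadz_mulr B_quad b2 y).
rewrite !(quadz_invr B_quad b1) !(quadz_invl B_quad x) !(quadz_invl B_quad y) !zin.
rewrite !(tmapD, tmapN, tmapZ, tswapD, tswapN, tswapZ) ?wD.
rewrite ?sl2 ?sr2 ?sl2' ?sr2' ?tswapD ?tswapZ.
rewrite e8 !tmapBl ?(tswapD, tswapN) ?(tmapD, tmapN).
rewrite e9 !tmapBl ?(tmapD, tmapN).
rewrite -e9' ?(dibi2 D_bialg) ?(dibi3 D_bialg).
tensor_ring b1.
Qed.

End Compatibility.

(** * Associativity of the product *)

Section Associativity.
Variables (k : fieldType) (D B : vectType k).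
Variables (dl dr : {bilinear D -> D -> D}) (m : {bilinear B -> B -> B}).
Hypotheses (D_diass : is_diass_algebra dl dr) (B_zin : is_zinbiel_algebra m).

Local Notation mul := (dzmul dl dr m).

(** The diassociative axioms leave three words in [d1], [d2], [d3]. For each of them the
    coefficients in [B] on the two sides agree by the Zinbiel identity. *)
Lemma dzmulA x y z : mul (mul x y) z = mul x (mul y z).
Proof.
elim/tens_ind: x => [d1 b1 | s t Hs Ht]; last by rewrite !linearDl /= Hs Ht.
elim/tens_ind: y => [d2 b2 | s t Hs Ht]; last first.
  by rewrite linearDr /= !linearDl /= linearDr /= Hs Ht.
elim/tens_ind: z => [d3 b3 | s t Hs Ht]; last by rewrite !linearDr /= Hs Ht.
rewrite !dzmulE linearDl linearDr /= !dzmulE.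
rewrite (diass_bar D_diass) (diass_drA D_diass) (diass_dr_dl D_diass).
rewrite -(diass_dl_dr D_diass) (diass_dlA D_diass) !B_zin !linearDr.
apply/matrixP => i j; rewrite !mxE; ring.
Qed.

End Associativity.

(** * Coassociativity of the coproduct *)

Section Coassociativity.
Variables (k : fieldType) (D B : vectType k).
Variables (m : {bilinear B -> B -> B}).
Variables (tl tr : {linear D -> tens D D}) (nu : {linear B -> tens B B}).
Variables (w : {skew_symmetric B}) (B_quad : is_quadratic_zinbiel m w).
Hypothesis nu_dual : is_zinbiel_dual m w nu.
Hypothesis D_codiass : is_diass_coalgebra tl tr.

Local Notation Delta := (dzcomul tl tr nu).
Local Notation ev := (@ev k D B w).

Lemma ev_dzcomul_id x y z T :
  tmap (tmap (ev x) (ev y)) (ev z) (tmap Delta id T) =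
  tmap tr id (tmap (ev (m x y)) (ev z) T) +
  tmap tl id (tmap (ev (m y x)) (ev z) T).
Proof.
have := tmap_comp tl idfun; have := tmap_comp tr idfun.
move=> /= Er El; rewrite !El !Er tmap_comp -tmapDl.
by apply: eq_tmap => // t /=; rewrite (ev_dzcomul_lin _ _ nu_dual).
Qed.

Lemma ev_id_dzcomul x y z T :
  tmap (ev x) (tmap (ev y) (ev z)) (tmap id Delta T) =
  tmap id tr (tmap (ev x) (ev (m y z)) T) +
  tmap id tl (tmap (ev x) (ev (m z y)) T).
Proof.
have := tmap_comp idfun tl; have := tmap_comp idfun tr.
move=> /= Er El; rewrite !El !Er tmap_comp -tmapDr.
by apply: eq_tmap => // t /=; rewrite (ev_dzcomul_lin _ _ nu_dual).
Qed.

Lemma dzcomulA t : tassoc (tmap Delta id (Delta t)) = tmap id Delta (Delta t).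
Proof.
elim/tens_ind: t => [d b | s t Hs Ht]; last by rewrite !(linearD, tmapD) /= Hs Ht.
have sep := separating_ev D (quadz_nondegenerate B_quad).
apply: (separating_inj (separating_tmap sep (separating_tmap sep sep))) => - [x [y z]] /=.
rewrite tmap_tassoc ev_dzcomul_id ev_id_dzcomul !(ev_dzcomul _ _ nu_dual).
have wD u v : w b (u + v) = w b u + w b v by exact: linearDr.
have zin := quadz_zinbiel B_quad.
rewrite !zin !(tmapD, tmapZ) !wD linearD /= !linearD /= !linearZ /=.
(* The coalgebra axioms leave three iterated coproducts: [tmap id tr (tr d)], [tmap id tl (tr d)]
   and [tassoc (tmap tl id (tl d))]. *)
rewrite (codiass_trA D_codiass) (codiass_tl_tr D_codiass).
rewrite (codiass_tr_tl D_codiass) (codiass_bar D_codiass) (codiass_trA D_codiass).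
have <- := codiass_tl_tr D_codiass d; have <- := codiass_tlA D_codiass d.
tensor_ring b.
Qed.

End Coassociativity.

(** * The ASI bialgebra structure *)

Section ASIBialgebra.
Variables (k : fieldType) (D B : vectType k).
Variables (dl dr : {bilinear D -> D -> D}) (tl tr : {linear D -> tens D D}).
Variables (D_bialg : is_diass_bialgebra dl dr tl tr).
Variables (m : {bilinear B -> B -> B}) (w : {skew_symmetric B}).
Variables (B_quad : is_quadratic_zinbiel m w).
Variables (nu : {linear B -> tens B B}) (nu_dual : is_zinbiel_dual m w nu).

Local Notation mul := (dzmul dl dr m).
Local Notation Delta := (dzcomul tl tr nu).
Local Notation ev := (@ev k D B w).

Lemma separating_ev2 : separating (fun p : B * B => tmap (ev p.1) (ev p.2)).
Proof.
have ev_sep := separating_ev D (quadz_nondegenerate B_quad).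
exact: (separating_tmap ev_sep ev_sep).
Qed.

(** Additivity in the multiplier, here and in the next three lemmas, reduces the compatibility
    conditions to pure tensors. *)
Lemma dzmulDr s t (T : tens (tens D B) (tens D B)) :
  tmap (fun a => mul a (s + t)) id T =
  tmap (fun a => mul a s) id T + tmap (fun a => mul a t) id T.
Proof. by rewrite -tmapDl; apply: eq_tmap => // a; rewrite /= linearDr. Qed.

Lemma dzid_mulDr s t (T : tens (tens D B) (tens D B)) :
  tmap id (fun a => mul a (s + t)) T =
  tmap id (fun a => mul a s) T + tmap id (fun a => mul a t) T.
Proof. by rewrite -tmapDr; apply: eq_tmap => // a; rewrite /= linearDr. Qed.

Lemma dzmulDl s t (T : tens (tens D B) (tens D B)) :
  tmap (mul (s + t)) id T = tmap (mul s) id T + tmap (mul t) id T.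
Proof. by rewrite -tmapDl; apply: eq_tmap => // a; rewrite /= linearDl. Qed.

Lemma dzid_mulDl s t (T : tens (tens D B) (tens D B)) :
  tmap id (mul (s + t)) T = tmap id (mul s) T + tmap id (mul t) T.
Proof. by rewrite -tmapDr; apply: eq_tmap => // a; rewrite /= linearDl. Qed.

Lemma dzcomulM a1 a2 :
  Delta (mul a1 a2) =
  tmap (fun a => mul a a2) id (Delta a1) + tmap id (mul a1) (Delta a2).
Proof.
elim/tens_ind: a1 => [d1 b1 | s t Hs Ht]; last first.
  by rewrite linearDl !linearD /= Hs Ht dzid_mulDl addrACA.
elim/tens_ind: a2 => [d2 b2 | s t Hs Ht]; last first.
  by rewrite linearDr !linearD /= Hs Ht dzmulDr addrACA.
apply: (separating_inj separating_ev2) => - [x y].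
exact: dzcomul_mul_pure.
Qed.

Lemma dzcomul_antisym a1 a2 :
  tmap (mul a1) id (Delta a2) - tmap id (fun a => mul a a1) (Delta a2) =
  tswap (tmap id (fun a => mul a a2) (Delta a1) - tmap (mul a2) id (Delta a1)).
Proof.
have addrBACA (V : zmodType) (u v u' v' : V) :
    (u + u') - (v + v') = (u - v) + (u' - v').
  by rewrite opprD addrACA.
elim/tens_ind: a1 => [d1 b1 | s t Hs Ht]; last first.
  by rewrite dzmulDl dzid_mulDr (linearD Delta) /= !tmapD !addrBACA tswapD Hs Ht.
elim/tens_ind: a2 => [d2 b2 | s t Hs Ht]; last first.
  by rewrite dzmulDl dzid_mulDr (linearD Delta) /= !tmapD !addrBACA tswapD Hs Ht.
apply: (separating_inj separating_ev2) => - [x y].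
exact: dzcomul_antisym_pure.
Qed.

Lemma dz_ASI_bialgebra : is_ASI_bialgebra mul Delta.
Proof.
split.
- exact: (dzmulA (dibi_algebra D_bialg) (quadz_zinbiel B_quad)).
- exact: (dzcomulA B_quad nu_dual (dibi_coalgebra D_bialg)).
- exact: dzcomulM.
- exact: dzcomul_antisym.
Qed.

End ASIBialgebra.

(** * Contractions of two copies of the copairing *)

Section Contraction.
Variables (k : fieldType) (B : vectType k) (m : {bilinear B -> B -> B}).
Variables (w : {skew_symmetric B}) (B_quad : is_quadratic_zinbiel m w).
Variables (K : seq (B * B)).
Hypothesis KP : forall x y, \sum_(q <- K) w q.1 x * w q.2 y = - w x y.

Let KPl x y c : \sum_(q <- K) w q.1 x * (w q.2 y * c) = - w x y * c.
Proof. by rewrite -KP mulr_suml; apply: eq_bigr => q _; rewrite mulrA. Qed.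

(** Invariance takes one leg out of the product, [KP] collapses the sum over its copy, and the same
    happens for the other copy. The six lemmas of this kind are the scalars in the Yang-Baxter
    tensor of [r • q]: the product is tested against [x], [z] or [y], in either order of its
    factors. *)
Lemma contract_mul1 x y z :
  \sum_(q <- K) \sum_(q' <- K) w (m q.1 q'.1) x * (w q.2 y * w q'.2 z)
  = - w (m x y) z - w (m y x) z.
Proof.
rewrite exchange_big /= -opprD -linearDl /= -KP; apply: eq_bigr => q' _.
under eq_bigr do rewrite (quadz_invr B_quad) mulNr.
by rewrite sumrN KPl mulNr opprK (quadz_invl B_quad) linearDr.
Qed.

Lemma contract_mul1C x y z :
  \sum_(q <- K) \sum_(q' <- K) w (m q'.1 q.1) x * (w q.2 y * w q'.2 z)
  = - w (m x z) y - w (m z x) y.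
Proof.
rewrite -contract_mul1 exchange_big; apply: eq_bigr => q _.
apply: eq_bigr => q' _ /=.
by rewrite (mulrC (w q'.2 y)).
Qed.

Lemma contract_mul2 x y z :
  \sum_(q <- K) \sum_(q' <- K) w q.1 x * (w q'.1 y * w (m q.2 q'.2) z)
  = - w (m x z) y - w (m z x) y.
Proof.
rewrite exchange_big /= -opprD -linearDl /= -(skewC w) -[RHS]opprK -KP -sumrN.
apply: eq_bigr => q' _.
under eq_bigr do rewrite (quadz_invr B_quad) mulrN mulrN (mulrC (w q'.1 y)).
rewrite sumrN KPl mulNr opprK (skewC w x) (quadz_invl B_quad) mulNr mulrC.
by rewrite !linearDr addrC.
Qed.

Lemma contract_mul2C x y z :
  \sum_(q <- K) \sum_(q' <- K) w q.1 x * (w q'.1 y * w (m q'.2 q.2) z)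
  = - w (m y z) x - w (m z y) x.
Proof.
rewrite -contract_mul2 exchange_big; apply: eq_bigr => q _.
apply: eq_bigr => q' _ /=.
by rewrite mulrCA.
Qed.

Lemma contract_mul12 x y z :
  \sum_(q <- K) \sum_(q' <- K) w q'.1 x * (w (m q.1 q'.2) y * w q.2 z)
  = w (m y z) x + w (m z y) x.
Proof.
rewrite exchange_big /= -linearDl /= (skewC w) -KP; apply: eq_bigr => q' _.
rewrite -mulr_sumr; congr (_ * _).
under eq_bigr do rewrite (quadz_invr B_quad) mulNr.
by rewrite sumrN KP opprK (quadz_invl B_quad) linearDr.
Qed.

Lemma contract_mul12C x y z :
  \sum_(q <- K) \sum_(q' <- K) w q'.1 x * (w (m q'.2 q.1) y * w q.2 z)
  = w (m y x) z + w (m x y) z.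
Proof.
rewrite -linearDl /= -[RHS]opprK -KP -sumrN; apply: eq_bigr => q _.
under eq_bigr do rewrite (quadz_invr B_quad) mulNr mulrN.
rewrite sumrN KPl mulNr opprK (skewC w x) (quadz_invl B_quad) mulNr.
by rewrite linearDr.
Qed.

End Contraction.

(** * Yang-Baxter tensors as sums over pure tensors *)

Ltac bilinearity :=
  split=> [v' | u'] a x y /=; rewrite !(linearPl, linearPr) //=;
  apply/matrixP => i j; rewrite !mxE; ring.

Section YangBaxter.
Variable k : fieldType.

(** The Yang-Baxter tensors are defined through basis coordinates; bilinearity in each pair lets any
    decomposition into pure tensors compute them. *)
Lemma tlift2_sumE (U V W : vectType k) (S : seq (U * V))
    (f : U -> V -> U -> V -> W) :
  (forall u v, bilinear_for *:%R *:%R (f u v)) ->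
  (forall u v, bilinear_for *:%R *:%R (fun u' v' => f u' v' u v)) ->
  let s := \sum_(p <- S) p.1 ⊗ p.2 in
  tlift (fun u v => tlift (f u v) s) s =
  \sum_(p <- S) \sum_(p' <- S) f p.1 p.2 p'.1 p'.2.
Proof.
move=> f_bil f_bil' s.
have E u v : tlift (f u v) s = \sum_(p' <- S) f u v p'.1 p'.2.
  exact: tlift_sumE.
rewrite tlift_sumE; first by apply: eq_bigr => p _; rewrite E.
split=> [v | u] a x y /=; rewrite !E scaler_sumr -big_split;
  apply: eq_bigr => p _ /=.
  by have [Hl _] := f_bil' p.1 p.2; rewrite Hl.
by have [_ Hr] := f_bil' p.1 p.2; rewrite Hr.
Qed.

Lemma tswap_sum (U V W : vectType k) (S : seq (U * V)) (f : V -> U -> W) :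
  bilinear_for *:%R *:%R f ->
  tlift f (tswap (\sum_(p <- S) p.1 ⊗ p.2)) = \sum_(p <- S) f p.2 p.1.
Proof.
move=> f_bil; rewrite (linear_sum (@tswap k U V)) linear_sum; apply: eq_bigr => p _.
by rewrite /= tswapE tliftE.
Qed.

(** Both sums are values of [tlift f], at the flipped tensor and at the tensor itself. Only the
    tensor is symmetric, the list of pairs may not be. *)
Lemma sum_tswap (U W : vectType k) (S : seq (U * U)) (f : U -> U -> W) :
  bilinear_for *:%R *:%R f ->
  tswap (\sum_(p <- S) p.1 ⊗ p.2) = \sum_(p <- S) p.1 ⊗ p.2 ->
  \sum_(p <- S) f p.2 p.1 = \sum_(p <- S) f p.1 p.2.
Proof. by move=> f_bil S_sym; rewrite -tswap_sum // S_sym tlift_sumE. Qed.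

Lemma tbullet_sum (D B : vectType k) (R : seq (D * D)) (K : seq (B * B)) :
  (\sum_(p <- R) p.1 ⊗ p.2) • (\sum_(q <- K) q.1 ⊗ q.2) =
  \sum_(p <- [seq ((p.1 ⊗ q.1), (p.2 ⊗ q.2)) | p <- R, q <- K]) p.1 ⊗ p.2.
Proof.
rewrite big_allpairs_dep linear_sumlz; apply: eq_bigr => p _.
by rewrite linear_sumr; apply: eq_bigr => q _; rewrite /= tbulletE.
Qed.

Lemma sum_scale_exchange (I J : Type) (R : seq I) (K : seq J) (V : lmodType k)
    (c : J -> J -> k) (X : I -> I -> V) :
  \sum_(p <- R) \sum_(q <- K) \sum_(p' <- R) \sum_(q' <- K) c q q' *: X p p' =
  (\sum_(q <- K) \sum_(q' <- K) c q q') *: \sum_(p <- R) \sum_(p' <- R) X p p'.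
Proof.
rewrite scaler_sumr; apply: eq_bigr => p _.
rewrite scaler_suml; apply: eq_bigr => q _.
rewrite scaler_sumr; apply: eq_bigr => p' _.
by rewrite scaler_suml.
Qed.

Section SymmetricTensor.
Variables (D W : vectType k) (R : seq (D * D)) (f : D -> D -> D -> D -> W).
Hypothesis R_sym : tswap (\sum_(p <- R) p.1 ⊗ p.2) = \sum_(p <- R) p.1 ⊗ p.2.

Lemma sum_tswapl :
  (forall u v, bilinear_for *:%R *:%R (fun u' v' => f u' v' u v)) ->
  \sum_(p <- R) \sum_(p' <- R) f p.2 p.1 p'.1 p'.2 =
  \sum_(p <- R) \sum_(p' <- R) f p.1 p.2 p'.1 p'.2.
Proof.
move=> f_bil; rewrite exchange_big [RHS]exchange_big; apply: eq_bigr => p' _ /=.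
exact: (sum_tswap (f_bil p'.1 p'.2)).
Qed.

Lemma sum_tswapr :
  (forall u v, bilinear_for *:%R *:%R (f u v)) ->
  \sum_(p <- R) \sum_(p' <- R) f p.1 p.2 p'.2 p'.1 =
  \sum_(p <- R) \sum_(p' <- R) f p.1 p.2 p'.1 p'.2.
Proof. by move=> f_bil; apply: eq_bigr => p _; apply: sum_tswap. Qed.

End SymmetricTensor.

Variables (D : vectType k) (dl dr : {bilinear D -> D -> D}) (R : seq (D * D)).
Let r := \sum_(p <- R) p.1 ⊗ p.2.

Lemma diass_YBE_sum : diass_YBE dl dr r =
  \sum_(p <- R) \sum_(p' <- R)
    (p.1 ⊗ (p'.1 ⊗ dr p.2 p'.2) - p'.1 ⊗ (dl p.1 p'.2 ⊗ p.2)
     - dr p.1 p'.1 ⊗ (p.2 ⊗ p'.2) + dl p.1 p'.1 ⊗ (p.2 ⊗ p'.2)).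
Proof.
rewrite /diass_YBE tlift2_sumE // => u v; bilinearity.
Qed.

Hypothesis r_sym : tswap r = r.

(* The negative of the Yang-Baxter equation permuted by
   u ⊗ (v ⊗ w) |-> w ⊗ (u ⊗ v). *)
Lemma diass_YBE_cycle : diass_YBE dl dr r = 0 ->
  \sum_(p <- R) \sum_(p' <- R)
    (p.1 ⊗ (p'.1 ⊗ dl p.2 p'.2) + p'.1 ⊗ (dr p.1 p'.2 ⊗ p.2)
     - dr p.1 p'.1 ⊗ (p.2 ⊗ p'.2) - p'.1 ⊗ (dl p.1 p'.2 ⊗ p.2)) = 0.
Proof.
rewrite diass_YBE_sum.
pose cyc (t : tens D (tens D D)) := tassoc (tswap t).
have cycE u v w : cyc (u ⊗ (v ⊗ w)) = v ⊗ (w ⊗ u) by rewrite /cyc tswapE tassocE.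
have cycD s t : cyc (s + t) = cyc s + cyc t by rewrite /cyc !linearD.
have cycN s : cyc (- s) = - cyc s by rewrite /cyc !linearN.
have cyc0 : cyc 0 = 0 by rewrite /cyc !linear0.
(* One turn of [cyc] sends the first leg to the end, so two turns bring the last leg to the
   front. *)
move=> /(congr1 (cyc \o cyc)) /=; rewrite !cyc0 => YBE0; apply/eqP.
rewrite -oppr_eq0; apply/eqP; apply: etrans YBE0.
clearbody cyc; have cyc_sum := big_morph cyc cycD cyc0.
rewrite !cyc_sum.
have cyc2E p : cyc (cyc (\sum_(p' <- R)
    (p.1 ⊗ (p'.1 ⊗ dr p.2 p'.2) - p'.1 ⊗ (dl p.1 p'.2 ⊗ p.2)
     - dr p.1 p'.1 ⊗ (p.2 ⊗ p'.2) + dl p.1 p'.1 ⊗ (p.2 ⊗ p'.2)))) =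
    \sum_(p' <- R)
    (dr p.2 p'.2 ⊗ (p.1 ⊗ p'.1) - p.2 ⊗ (p'.1 ⊗ dl p.1 p'.2)
     - p'.2 ⊗ (dr p.1 p'.1 ⊗ p.2) + p'.2 ⊗ (dl p.1 p'.1 ⊗ p.2)).
  by rewrite !cyc_sum; apply: eq_bigr => p' _; rewrite !(cycD, cycN, cycE).
rewrite (eq_bigr _ (fun p _ => cyc2E p)).
have sum4 F1 F2 F3 F4 :
    \sum_(p <- R) \sum_(p' <- R) (F1 p p' + F2 p p' + F3 p p' + F4 p p')
  = \sum_(p <- R) \sum_(p' <- R) F1 p p' + \sum_(p <- R) \sum_(p' <- R) F2 p p'
  + \sum_(p <- R) \sum_(p' <- R) F3 p p' + \sum_(p <- R) \sum_(p' <- R) F4 p p'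
  :> tens D (tens D D).
  by rewrite -!big_split; apply: eq_bigr => p _; rewrite -!big_split.
have sumN F : \sum_(p <- R) \sum_(p' <- R) - F p p' =
    - \sum_(p <- R) \sum_(p' <- R) F p p' :> tens D (tens D D).
  by rewrite -sumrN; apply: eq_bigr => p _; rewrite sumrN.
rewrite !sum4 !sumN.
(* Symmetry of [r] restores the index pattern of the claim, by exchanging legs in both copies for
   this sum and in one copy for the next three. *)
have -> : \sum_(p <- R) \sum_(p' <- R) dr p.2 p'.2 ⊗ (p.1 ⊗ p'.1)
    = \sum_(p <- R) \sum_(p' <- R) dr p.1 p'.1 ⊗ (p.2 ⊗ p'.2).
  transitivity (\sum_(p <- R) \sum_(p' <- R) dr p.1 p'.2 ⊗ (p.2 ⊗ p'.1)).
    by apply: (sum_tswapl (f := fun u v u' v' => dr u v' ⊗ (v ⊗ u'))) => // *; bilinearity.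
  by apply: (sum_tswapr (f := fun u v u' v' => dr u u' ⊗ (v ⊗ v'))) => // *; bilinearity.
have -> : \sum_(p <- R) \sum_(p' <- R) p.2 ⊗ (p'.1 ⊗ dl p.1 p'.2)
    = \sum_(p <- R) \sum_(p' <- R) p.1 ⊗ (p'.1 ⊗ dl p.2 p'.2).
  by apply: (sum_tswapl (f := fun u v u' v' => u ⊗ (u' ⊗ dl v v'))) => // *; bilinearity.
have -> : \sum_(p <- R) \sum_(p' <- R) p'.2 ⊗ (dr p.1 p'.1 ⊗ p.2)
    = \sum_(p <- R) \sum_(p' <- R) p'.1 ⊗ (dr p.1 p'.2 ⊗ p.2).
  by apply: (sum_tswapr (f := fun u v u' v' => u' ⊗ (dr u v' ⊗ v))) => // *; bilinearity.
have -> : \sum_(p <- R) \sum_(p' <- R) p'.2 ⊗ (dl p.1 p'.1 ⊗ p.2)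
    = \sum_(p <- R) \sum_(p' <- R) p'.1 ⊗ (dl p.1 p'.2 ⊗ p.2).
  by apply: (sum_tswapr (f := fun u v u' v' => u' ⊗ (dl u v' ⊗ v))) => // *; bilinearity.
rewrite !opprD !opprK; do 4![move: (\sum_(p <- R) _) => ?].
by apply/matrixP => i j; rewrite !mxE; ring.
Qed.

End YangBaxter.

Section AssociativeYangBaxter.
Variables (k : fieldType) (A : vectType k) (m : {bilinear A -> A -> A}).

Lemma assoc_YBE_sum (S : seq (A * A)) :
  assoc_YBE m (\sum_(a <- S) a.1 ⊗ a.2) =
  \sum_(a <- S) \sum_(b <- S)
    (m a.1 b.1 ⊗ (a.2 ⊗ b.2) + a.1 ⊗ (b.1 ⊗ m a.2 b.2)
     - b.1 ⊗ (m a.1 b.2 ⊗ a.2)).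
Proof.
by rewrite /assoc_YBE tlift2_sumE // => u v; bilinearity.
Qed.

End AssociativeYangBaxter.

(** * The triangular case *)

Section Triangular.
Variables (k : fieldType) (D B : vectType k).
Variables (dl dr : {bilinear D -> D -> D}).
Variables (m : {bilinear B -> B -> B}) (w : {skew_symmetric B}).
Variables (B_quad : is_quadratic_zinbiel m w).
Variables (r : tens D D) (q : tens B B).
Hypothesis qP : forall x y, tform w q (x ⊗ y) = - w x y.
Hypothesis r_sym : tswap r = r.

Local Notation mul := (dzmul dl dr m).
Local Notation ev := (@ev k D B w).

(** The factor [r] is symmetric, and [q] is skew because [w] is. *)
Lemma tswap_bullet_copairing : tswap (r • q) = - (r • q).
Proof.
apply: (separating_inj (separating_ev2 D B_quad)) => - [x y] /=.
rewrite -tswap_tmap tmapN !ev_tbullet !qP tswapZ r_sym.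
by rewrite (skewC w y) opprK scaleNr opprK.
Qed.

Lemma assoc_YBE_bullet_copairing :
  diass_YBE dl dr r = 0 -> assoc_YBE mul (r • q) = 0.
Proof.
have [R rE] := tens_sum r; have [K qE] := tens_sum q => YBE0.
have KP x y : \sum_(p <- K) w p.1 x * w p.2 y = - w x y.
  rewrite -qP qE (big_morph (fun t => tform w t _)
    (fun s t => tformD w s t _) (id1 := 0)).
    by apply: eq_bigr => p _; rewrite tform_tpure.
  by rewrite /tform linear0.
have R_sym := r_sym; rewrite {}rE in R_sym YBE0 *.
have cycle0 := diass_YBE_cycle R_sym YBE0.
rewrite diass_YBE_sum in YBE0.
rewrite qE tbullet_sum assoc_YBE_sum.
have sep := separating_ev D (quadz_nondegenerate B_quad).
apply: (separating_inj (separating_tmap sep (separating_tmap sep sep))) => - [x [y z]].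
rewrite linear0 /= big_allpairs_dep /=.
set E := tmap (ev x) (tmap (ev y) (ev z)).
have EE a b c : E (a ⊗ (b ⊗ c)) = ev x a ⊗ (ev y b ⊗ ev z c).
  by rewrite /E tmapE /= tmapE.
have ev_mul v d1 b1 d2 b2 : ev v (mul (d1 ⊗ b1) (d2 ⊗ b2)) =
    w (m b1 b2) v *: dr d1 d2 + w (m b2 b1) v *: dl d1 d2.
  by rewrite dzmulE linearD /= !evE.
have ED s t : E (s + t) = E s + E t by exact: tmapD.
have E0 : E 0 = 0 by exact: linear0.
have EN t : E (- t) = - E t by exact: tmapN.
have E_sum := big_morph E ED E0; clearbody E.
(* The product sits in the first, third or second leg for [T1], [T2], [T3]; primes mark [dl] in
   place of [dr]. *)
pose T1 (p p' : D * D) := dr p.1 p'.1 ⊗ (p.2 ⊗ p'.2).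
pose T1' (p p' : D * D) := dl p.1 p'.1 ⊗ (p.2 ⊗ p'.2).
pose T2 (p p' : D * D) := p.1 ⊗ (p'.1 ⊗ dr p.2 p'.2).
pose T2' (p p' : D * D) := p.1 ⊗ (p'.1 ⊗ dl p.2 p'.2).
pose T3 (p p' : D * D) := p'.1 ⊗ (dr p.1 p'.2 ⊗ p.2).
pose T3' (p p' : D * D) := p'.1 ⊗ (dl p.1 p'.2 ⊗ p.2).
transitivity (\sum_(p <- R) \sum_(q <- K) \sum_(p' <- R) \sum_(q' <- K)
   ((w (m q.1 q'.1) x * (w q.2 y * w q'.2 z)) *: T1 p p'
  + (w (m q'.1 q.1) x * (w q.2 y * w q'.2 z)) *: T1' p p'
  + (w q.1 x * (w q'.1 y * w (m q.2 q'.2) z)) *: T2 p p'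
  + (w q.1 x * (w q'.1 y * w (m q'.2 q.2) z)) *: T2' p p'
  + (w q'.1 x * (w (m q.1 q'.2) y * w q.2 z)) *: - T3 p p'
  + (w q'.1 x * (w (m q'.2 q.1) y * w q.2 z)) *: - T3' p p')).
  rewrite E_sum; apply: eq_bigr => p _ /=.
  rewrite E_sum; apply: eq_bigr => q' _ /=.
  rewrite big_allpairs_dep /= E_sum; apply: eq_bigr => p' _ /=.
  rewrite E_sum; apply: eq_bigr => q'' _ /=.
  rewrite !ED EN !EE !ev_mul !evE.
  rewrite !(linearDl, linearDr, linearZl_LR, linearZr_LR) /=.
  by rewrite !(scalerDr, scalerA, scalerN, opprD, addrA, mulrA).
have S4D F G : \sum_(p <- R) \sum_(q <- K) \sum_(p' <- R) \sum_(q' <- K)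
    (F p q p' q' + G p q p' q')
  = \sum_(p <- R) \sum_(q <- K) \sum_(p' <- R) \sum_(q' <- K) F p q p' q'
  + \sum_(p <- R) \sum_(q <- K) \sum_(p' <- R) \sum_(q' <- K) G p q p' q'
  :> tens D (tens D D).
  rewrite -big_split; apply: eq_bigr => ? _; rewrite -big_split; apply: eq_bigr => ? _.
  by rewrite -big_split; apply: eq_bigr => ? _; rewrite -big_split.
have S2D F G : \sum_(p <- R) \sum_(p' <- R) (F p p' + G p p')
  = \sum_(p <- R) \sum_(p' <- R) F p p' + \sum_(p <- R) \sum_(p' <- R) G p p'
  :> tens D (tens D D).
  by rewrite -!big_split; apply: eq_bigr => p _; rewrite -!big_split.
have S2N F : \sum_(p <- R) \sum_(p' <- R) - F p p' =
    - \sum_(p <- R) \sum_(p' <- R) F p p' :> tens D (tens D D).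
  by rewrite -sumrN; apply: eq_bigr => p _; rewrite sumrN.
(* Each of the six families splits into a scalar summed over [K] times a tensor summed over [R]. *)
rewrite !S4D !sum_scale_exchange !S2N.
rewrite !S2D !S2N in YBE0 cycle0.
rewrite (contract_mul1 B_quad KP) (contract_mul1C B_quad KP)
  (contract_mul2 B_quad KP) (contract_mul2C B_quad KP)
  (contract_mul12 B_quad KP) (contract_mul12C B_quad KP).
have w_sym a b c : w (m a b) c = w (m c b) a.
  by rewrite (quadz_invr B_quad) (skewC w a) opprK.
(* All scalars become combinations of [w (m x y) z], the coefficient of [YBE0], and [w (m y x) z],
   the coefficient of [cycle0]. Both equations are then solved for their last sum. *)
rewrite (w_sym z y x) (w_sym z x y) (w_sym y z x) (quadz_invl B_quad x z y).
rewrite (skewC w z (m x y)) (skewC w z (m y x)).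
rewrite -(addr0_eq YBE0) -(subr0_eq cycle0).
do ![move: (\sum_(p <- R) _) => ?].
by apply/matrixP => i j; rewrite !mxE; ring.
Qed.

Variables (tl tr : {linear D -> tens D D}).
Variables (nu : {linear B -> tens B B}) (nu_dual : is_zinbiel_dual m w nu).
Hypothesis tlE : forall d,
  tl d = tmap id (dr d \- dl d) r - tmap (fun e => dr e d) id r.
Hypothesis trE : forall d,
  tr d = - (tmap ((fun e => dr e d) \- (fun e => dl e d)) id r
            + tmap id (dl d) r).

(** Tested at [x] and [y], the right side is a combination of [w b (m x y)] and [w b (m y x)], whose
    coefficients are the formulas [trE] and [tlE]. *)
Lemma dzcomul_coboundary a :
  dzcomul tl tr nu a =
  tmap id (mul a) (r • q) - tmap (fun t => mul t a) id (r • q).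
Proof.
elim/tens_ind: a => [d b | s t Hs Ht]; last first.
  by rewrite linearD /= Hs Ht dzid_mulDl dzmulDr opprD addrACA.
apply: (separating_inj (separating_ev2 D B_quad)) => - [x y] /=.
rewrite (ev_dzcomul _ _ nu_dual) tmapD tmapN.
rewrite (ev_id_mull _ _ B_quad) (ev_mulr_id _ _ B_quad) !ev_tbullet !qP.
rewrite tlE trE tmapBl tmapBr !(tmapD, tmapZ).
rewrite (quadz_invr B_quad b) (quadz_invl B_quad x b).
rewrite (quadz_mull B_quad x b) (quadz_mulr B_quad x y).
tensor_ring b.
Qed.

End Triangular.

Theorem theoremI (k : fieldType) (k_char0 : [pchar k] =i pred0)
    (D B : vectType k)
    (dl dr : {bilinear D -> D -> D}) (tl tr : {linear D -> tens D D})
    (D_bialg : is_diass_bialgebra dl dr tl tr)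
    (m : {bilinear B -> B -> B}) (w : {skew_symmetric B})
    (B_quad : is_quadratic_zinbiel m w)
    (nu : {linear B -> tens B B}) (nu_dual : is_zinbiel_dual m w nu) :
  is_ASI_bialgebra (dzmul dl dr m) (dzcomul tl tr nu) /\
  (is_triangular_diass_bialgebra dl dr tl tr ->
   is_triangular_ASI_bialgebra (dzmul dl dr m) (dzcomul tl tr nu)).
Proof.
have ASI := dz_ASI_bialgebra D_bialg B_quad nu_dual; split=> //.
case=> _ [r [r_sym r_YBE tlE trE]]; split=> //.
have [q qP] := nondegenerate_copairing (quadz_nondegenerate B_quad).
exists (r • q); split.
- exact: (tswap_bullet_copairing B_quad qP r_sym).
- exact: (assoc_YBE_bullet_copairing B_quad qP r_sym r_YBE).
- exact: (dzcomul_coboundary B_quad qP nu_dual tlE trE).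
Qed.
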